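(* Let $\Phi=(G,\varphi)$ be a $\mathbb{T}$-gain graph on a connected bipartite graph $G$. Then $\Phi$ is distance compatible if and only if $\Phi$ is balanced.
   Context: $\mathbb{T}=\{z\in\mathbb{C}:|z|=1\}$. A $\mathbb{T}$-gain graph $\Phi=(G,\varphi)$ on a simple graph $G$ with vertices $v_1,\dots,v_n$ assigns to each oriented edge $\overrightarrow{e}_{i,j}$ an element $\varphi(\overrightarrow{e}_{i,j})\in\mathbb{T}$ with $\varphi(\overrightarrow{e}_{j,i})=\varphi(\overrightarrow{e}_{i,j})^{-1}$. The gain of an oriented path or cycle is the product of the gains of its consecutive oriented edges; $\Phi$ is balanced if every cycle has gain $1$. $d(s,t)$ is the graph distance. $\mathcal{P}(s,t)$ is the set of oriented shortest paths from $s$ to $t$; $\mathcal{P}^{\max}(s,t)$ (resp. $\mathcal{P}^{\min}(s,t)$) is the set of those whose gain has maximum (resp. minimum) real part in $\mathcal{P}(s,t)$. For a total order $<$ and $s<t$, $\varphi^{<}_{\max}(s,t)$ is the gain of a path in $\mathcal{P}^{\max}(s,t)$ with maximum imaginary part of gain among paths in $\mathcal{P}^{\max}(s,t)$, and $\varphi^{<}_{\max}(t,s)=\overline{\varphi^{<}_{\max}(s,t)}$; $\varphi^{<}_{\min}(s,t)$ is the gain of a path in $\mathcal{P}^{\min}(s,t)$ with minimum imaginary part of gain among paths in $\mathcal{P}^{\min}(s,t)$, and $\varphi^{<}_{\min}(t,s)=\overline{\varphi^{<}_{\min}(s,t)}$. $D^{\max}_{<}(\Phi)=(\varphi^{<}_{\max}(v_i,v_j)d(v_i,v_j))$,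 $D^{\min}_{<}(\Phi)=(\varphi^{<}_{\min}(v_i,v_j)d(v_i,v_j))$. $\Phi$ is distance compatible if $D^{\max}_{<}(\Phi)=D^{\min}_{<}(\Phi)$ for the standard order $v_1<\dots<v_n$. *)

(* Defs.v *)
From HB Require Import structures.
From mathcomp Require Import all_boot all_order all_algebra.
From mathcomp Require Import complex reals.

Set Implicit Arguments.
Unset Strict Implicit.
Unset Printing Implicit Defensive.

Import Order.TTheory GRing.Theory Num.Theory.
Local Open Scope ring_scope.

Record sgraph (n : nat) := SGraph {
  adj :> rel 'I_n;
  adj_sym : symmetric adj;
  adj_irr : irreflexive adj
}.

Section Graphs.
Variables (n : nat) (G : sgraph n).

Definition connected_graph : Prop := forall x y : 'I_n, connect G x y.

Definition bipartite : Prop :=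
  exists A : {set 'I_n}, forall x y, G x y -> (x \in A) != (y \in A).

(* A path is encoded by its source s and the list p of its later vertices, so
   that its length is size p. *)
Definition is_path (s t : 'I_n) (p : seq 'I_n) : bool :=
  [&& path G s p, last s p == t & uniq (s :: p)].

(* The least length of a path from s to t; a path has fewer than n edges, and
   the value is n when s and t are not connected. *)
Definition dist (s t : 'I_n) : nat :=
  find (fun k => [exists p : k.-tuple 'I_n, is_path s t p]) (iota 0 n).

Definition shortest_paths (s t : 'I_n) : {set (dist s t).-tuple 'I_n} :=
  [set p : (dist s t).-tuple 'I_n | is_path s t p].

End Graphs.

(* Only the values of the gain function on pairs of adjacent vertices, i.e. on
   oriented edges, are constrained or ever used. *)
Record gain_graph (R : realType) (n : nat) (G : sgraph n) := GainGraph {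
  gain :> 'I_n -> 'I_n -> R[i];
  gain_norm : forall x y, G x y -> `|gain x y| = 1;
  gain_inv : forall x y, G x y -> gain y x = (gain x y)^-1
}.

Section GainGraphs.
Variables (R : realType) (n : nat) (G : sgraph n) (Phi : gain_graph R G).

Fixpoint path_gain (s : 'I_n) (p : seq 'I_n) : R[i] :=
  if p is x :: p' then Phi s x * path_gain x p' else 1.

Definition cycle_gain (c : seq 'I_n) : R[i] :=
  if c is x :: p then path_gain x (rcons p x) else 1.

Definition balanced : Prop :=
  forall c : seq 'I_n, (2 < size c)%N -> cycle G c -> uniq c ->
    cycle_gain c = 1.

Definition shortest_max (s t : 'I_n) : {set (dist G s t).-tuple 'I_n} :=
  [set p in shortest_paths G s t | [forall q in shortest_paths G s t,
     complex.Re (path_gain s q) <= complex.Re (path_gain s p)]].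

Definition shortest_min (s t : 'I_n) : {set (dist G s t).-tuple 'I_n} :=
  [set p in shortest_paths G s t | [forall q in shortest_paths G s t,
     complex.Re (path_gain s p) <= complex.Re (path_gain s q)]].

(* The gain of a path of shortest_max s t with greatest imaginary part; such
   paths all have the same gain.  The value 0 is taken only when there is no
   path from s to t. *)
Definition opt_max (s t : 'I_n) : R[i] :=
  if [pick p in shortest_max s t | [forall q in shortest_max s t,
        complex.Im (path_gain s q) <= complex.Im (path_gain s p)]] is Some p
  then path_gain s p else 0.

Definition opt_min (s t : 'I_n) : R[i] :=
  if [pick p in shortest_min s t | [forall q in shortest_min s t,
        complex.Im (path_gain s p) <= complex.Im (path_gain s q)]] is Some p
  then path_gain s p else 0.

(* lt is a strict total order on the vertices.  On the diagonal the value is 1,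
   the gain of the empty path, and is multiplied by a zero distance below. *)
Definition gain_max (lt : rel 'I_n) (s t : 'I_n) : R[i] :=
  if lt s t then opt_max s t else (opt_max t s)^*.

Definition gain_min (lt : rel 'I_n) (s t : 'I_n) : R[i] :=
  if lt s t then opt_min s t else (opt_min t s)^*.

Definition Dmax (lt : rel 'I_n) : 'M[R[i]]_n :=
  \matrix_(i, j) (gain_max lt i j * (dist G i j)%:R).

Definition Dmin (lt : rel 'I_n) : 'M[R[i]]_n :=
  \matrix_(i, j) (gain_min lt i j * (dist G i j)%:R).

Definition std_lt : rel 'I_n := fun i j => (i < j)%N.

Definition distance_compatible : Prop := Dmax std_lt = Dmin std_lt.

End GainGraphs.

(* Main.v *)
(** Distance compatibility says that all shortest paths between two vertices
    have the same gain. In a bipartite graph the distances from a root [s] to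
    the ends of an edge [u v] differ by exactly one, so the edge prolongs a
    shortest path; hence the gain of the shortest paths from [s] is a potential
    for [Phi], and [Phi] is balanced. Conversely, in a balanced gain graph every
    closed walk has gain 1, hence any two walks with the same ends have the same
    gain. *)
Require Import Defs.
From mathcomp Require Import all_boot all_order all_algebra.
From mathcomp Require Import complex reals.

Set Implicit Arguments.
Unset Strict Implicit.
Unset Printing Implicit Defensive.

Import Order.TTheory GRing.Theory Num.Theory.
Local Open Scope ring_scope.

(** * Shortest walks, distances and their parity *)

Section Distance.
Variables (n : nat) (G : sgraph n).
Implicit Types s t u v : 'I_n.

Lemma dist_le_path s t p : is_path G s t p -> (dist G s t <= size p)%N.
Proof.
(* The search in [dist] only covers lengths below [n]; distinctness of the vertices keeps [p] within
   that range. *)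
move=> isp; have ltpn : (size p < n)%N.
  have /and3P[_ _ /card_uniqP /= <-] := isp.
  by rewrite -[leqRHS](card_ord n) max_card.
rewrite leqNgt; apply/negP => /(before_find 0%N).
rewrite nth_iota // add0n => /existsP; case.
by exists (in_tuple p).
Qed.

Lemma dist_le_walk s t p :
  path G s p -> last s p = t -> (dist G s t <= size p)%N.
Proof.
move=> /shortenP[p' Gp' Up' sub_p'p] lastp.
have /= /andP[_ /uniq_leq_size/(_ sub_p'p) le_p'p] := Up'.
by apply: leq_trans le_p'p; apply: dist_le_path; rewrite /is_path Gp' lastp eqxx.
Qed.

(** Shortcutting the walk gives a path through some of its vertices, which cannot be shorter than
    the distance; so no vertex is lost and none was repeated. *)
Lemma shortest_walk_is_path s t p :
  path G s p -> last s p = t -> size p = dist G s t -> is_path G s t p.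
Proof.
move=> Gp lastp szp; rewrite /is_path Gp lastp eqxx /=.
move: Gp lastp szp => /shortenP[p' Gp' Up' sub_p'p] lastp szp.
have le_pp' : (size p <= size p')%N by rewrite szp dist_le_walk.
have /= /andP[s_p' Up1] := Up'.
have [_ eq_p'p] := uniq_min_size Up1 sub_p'p le_pp'.
by rewrite -eq_p'p s_p' (leq_size_uniq Up1).
Qed.

Lemma shortest_paths_nonempty s t :
  connect G s t -> exists p, p \in shortest_paths G s t.
Proof.
move=> /connectP[p /shortenP[p' Gp' Up' _] ->].
have isp : is_path G s (last s p') p' by rewrite /is_path Gp' eqxx.
have hasp : has (fun k => [exists q : k.-tuple 'I_n, is_path G s (last s p') q])
    (iota 0 n).
  apply/hasP; exists (size p').
    rewrite mem_iota add0n; have /card_uniqP /= <- := Up'.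
    by rewrite -[leqRHS](card_ord n) max_card.
  by apply/existsP; exists (in_tuple p').
have := nth_find 0%N hasp; rewrite nth_iota ?add0n; last first.
  by rewrite -[ltnRHS](size_iota 0 n) -has_find.
by move=> /existsP[q isq]; exists q; rewrite inE.
Qed.

Lemma dist_eq0 s t : connect G s t -> (dist G s t == 0%N) = (s == t).
Proof.
move=> cst; apply/idP/eqP => [/eqP d0|<-].
  have [p] := shortest_paths_nonempty cst.
  rewrite inE => /and3P[_ /eqP lastp _].
  have /size0nil p0 : size p = 0%N by rewrite size_tuple.
  by rewrite -lastp p0.
by rewrite -leqn0 (@dist_le_walk s s [::]).
Qed.

Lemma dist_adj_le s u v :
  connect G s u -> G u v -> (dist G s v <= (dist G s u).+1)%N.
Proof.
move=> /shortest_paths_nonempty[p]; rewrite inE => /and3P[Gp /eqP lastp _] Guv.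
rewrite -(size_tuple p) -(size_rcons p v).
by apply: dist_le_walk; rewrite ?last_rcons // rcons_path Gp lastp.
Qed.

Lemma mem_last_walk (A : {set 'I_n}) s p :
  (forall x y, G x y -> (x \in A) != (y \in A)) -> path G s p ->
  (last s p \in A) = (s \in A) (+) odd (size p).
Proof.
move=> bipA; elim: p s => [|x p IHp] s /=; first by rewrite addbF.
move=> /andP[/bipA + /IHp->].
by case: (s \in A); case: (x \in A); case: (odd _).
Qed.

(** Adjacency bounds the difference by one, and the distances have opposite parities because [u] and
    [v] lie in different classes. *)
Lemma bipartite_dist_adj s u v :
    bipartite G -> connect G s u -> connect G s v -> G u v ->
  dist G s v = (dist G s u).+1 \/ dist G s u = (dist G s v).+1.
Proof.
move=> [A bipA] csu csv Guv.
have odd_dist w : connect G s w -> (w \in A) = (s \in A) (+) odd (dist G s w).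
  move=> /shortest_paths_nonempty[p]; rewrite inE => /and3P[Gp /eqP lastp _].
  by rewrite -{1}lastp (mem_last_walk bipA Gp) size_tuple.
have := dist_adj_le csu Guv; have := Guv; rewrite adj_sym => /(dist_adj_le csv).
have := bipA _ _ Guv; rewrite (odd_dist u) // (odd_dist v) //.
have [ltuv _ _ levu|ltvu _ leuv _|->] := ltngtP (dist G s u) (dist G s v).
- by left; apply/eqP; rewrite eqn_leq ltuv levu.
- by right; apply/eqP; rewrite eqn_leq ltvu leuv.
- by rewrite eqxx.
Qed.

End Distance.

(** * Gains of walks, balance and extremal gains *)

Section Gain.
Variables (R : realType) (n : nat) (G : sgraph n) (Phi : gain_graph R G).
Implicit Types s t u v x : 'I_n.

Lemma gain_neq0 u v : G u v -> Phi u v != 0.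
Proof. by move=> Guv; rewrite -normr_eq0 (gain_norm Phi Guv) oner_neq0. Qed.

Lemma path_gain_cat s p q :
  path_gain Phi s (p ++ q) = path_gain Phi s p * path_gain Phi (last s p) q.
Proof. by elim: p s => [|x p IHp] s /=; rewrite ?mul1r // IHp mulrA. Qed.

Lemma path_gain_rcons s p x :
  path_gain Phi s (rcons p x) = path_gain Phi s p * Phi (last s p) x.
Proof. by rewrite -cats1 path_gain_cat /= mulr1. Qed.

Lemma path_gain_neq0 s p : path G s p -> path_gain Phi s p != 0.
Proof.
elim: p s => [|x p IHp] s /=; first by rewrite oner_neq0.
by move=> /andP[Gsx Gp]; rewrite mulf_neq0 ?gain_neq0 ?IHp.
Qed.

(** As a walk omits its source from the list, the reverse of [p] drops the end and regains [s]: it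
    is [rev (belast s p)]. *)
Lemma path_gain_rev s p : path G s p ->
  path_gain Phi (last s p) (rev (belast s p)) = (path_gain Phi s p)^-1.
Proof.
elim: p s => [|x p IHp] s /=; first by rewrite invr1.
move=> /andP[Gsx Gp]; rewrite rev_cons path_gain_rcons IHp // invfM mulrC.
congr (_ * _); rewrite -(gain_inv Phi Gsx); congr (Phi _ _).
by case: p {IHp Gp} => //= y p; rewrite rev_cons last_rcons.
Qed.

(* A closed walk that revisits a vertex splits into two shorter closed walks. *)
Lemma balanced_closed_walk x p :
  balanced Phi -> path G x p -> last x p = x -> path_gain Phi x p = 1.
Proof.
move=> bal; have [m] := ubnP (size p).
elim: m x p => // m IHm x p; rewrite ltnS => lepm Gp lastp.
have [Up|/uniqPn-/(_ x)[i [j [ltij ltjp eqij]]]] := boolP (uniq p).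
  (* Without repetition the walk is empty, a loop (excluded), an edge travelled back and forth, or a
     genuine cycle. *)
  case/lastP: p => [|p y] // in lepm Gp lastp Up *.
  rewrite last_rcons in lastp; rewrite {}lastp in Gp Up *.
  have Uxp : uniq (x :: p) by rewrite /= -rcons_uniq.
  case: p => [|y1 [|y2 p]] /= in {lepm} Gp {Up} Uxp *.
  - by rewrite adj_irr in Gp.
  - case/and3P: Gp => Gxy _ _.
    by rewrite mulr1 (gain_inv Phi Gxy) divff ?gain_neq0.
  - exact: (bal [:: x, y1, y2 & p]).
(* The vertex [nth x p i] is reached after [i.+1] steps. The loop [p2] joins its two visits, and
   [p1 ++ p3] is what remains; both are shorter than [p] because [p1] and [p2] are nonempty. *)
pose p1 := take i.+1 p; pose p2 := drop i.+1 (take j.+1 p).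
pose p3 := drop j.+1 p.
have lt_ip := ltn_trans ltij ltjp.
have Ep : p = p1 ++ p2 ++ p3.
  rewrite catA -[LHS](cat_take_drop j.+1); congr (_ ++ _).
  rewrite -[LHS](cat_take_drop i.+1) take_takel //; exact: ltnW.
have last1 : last x p1 = nth x p i by rewrite /p1 (take_nth x) // last_rcons.
have last2 : last (last x p1) p2 = nth x p i.
  rewrite -last_cat.
  have -> : p1 ++ p2 = take j.+1 p.
    by rewrite -[RHS](cat_take_drop i.+1) take_takel //; exact: ltnW.
  by rewrite (take_nth x) // last_rcons.
have sz1 : (0 < size p1)%N by rewrite size_takel.
have sz2 : (0 < size p2)%N.
  by rewrite size_drop size_takel // subn_gt0 ltnS.
move: lepm Gp lastp; rewrite Ep !size_cat !cat_path !last_cat !path_gain_cat.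
rewrite last2 last1 => lepm /and3P[G1 G2 G3] last3.
rewrite (IHm (nth x p i) p2) ?mul1r //; last 2 first.
- apply: leq_trans lepm.
  by rewrite -[ltnLHS]add0n -addSn leq_add // leq_addr.
- by rewrite -{1}last1.
rewrite -last1 -path_gain_cat; apply: IHm.
- apply: leq_trans lepm; rewrite size_cat ltn_add2l.
  by rewrite -[ltnLHS]add0n ltn_add2r.
- by rewrite cat_path G1 last1.
- by rewrite last_cat last1.
Qed.

(** Following [p] and returning along [q] is a closed walk. *)
Lemma balanced_walk_gain s p q :
    balanced Phi -> path G s p -> path G s q -> last s p = last s q ->
  path_gain Phi s p = path_gain Phi s q.
Proof.
move=> bal Gp Gq eq_last.
have : path_gain Phi s (p ++ rev (belast s q)) = 1.
  apply: balanced_closed_walk => //.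
    rewrite cat_path Gp eq_last rev_path.
    by rewrite (eq_path (e' := G)) // => x y; rewrite adj_sym.
  rewrite last_cat eq_last.
  by case: q {Gq eq_last} => //= y q; rewrite rev_cons last_rcons.
rewrite path_gain_cat eq_last path_gain_rev //; exact: divr1_eq.
Qed.

(* Walking around a closed walk telescopes the potential. *)
Lemma potential_balanced (theta : 'I_n -> R[i]) :
    (forall u, theta u != 0) ->
    (forall u v, G u v -> theta v = theta u * Phi u v) ->
  balanced Phi.
Proof.
move=> th0 thE; have walkE p s : path G s p ->
    theta (last s p) = theta s * path_gain Phi s p.
  elim: p s => [|x p IHp] s /=; first by rewrite mulr1.
  by move=> /andP[Gsx /IHp->]; rewrite (thE _ _ Gsx) mulrA.
case=> [|x p] // _ /= /walkE; rewrite last_rcons => E _.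
by apply: (mulfI (th0 x)); rewrite -E mulr1.
Qed.

(** Maximizing the real part, then the imaginary part among the maximizers, shows that the [pick] in
    [opt_max] succeeds, so the default 0 does not occur. *)
Lemma opt_maxP s t : connect G s t -> exists2 p,
  p \in shortest_paths G s t & opt_max Phi s t = path_gain Phi s p /\
  forall q, q \in shortest_paths G s t ->
    complex.Re (path_gain Phi s q) <= complex.Re (path_gain Phi s p) /\
    (complex.Re (path_gain Phi s q) = complex.Re (path_gain Phi s p) ->
     complex.Im (path_gain Phi s q) <= complex.Im (path_gain Phi s p)).
Proof.
move=> /shortest_paths_nonempty[p0 sp0].
have [p1 sp1 max1] := Order.TotalTheory.arg_maxP
  (fun p : (dist G s t).-tuple 'I_n => complex.Re (path_gain Phi s p)) sp0.
have mp1 : p1 \in shortest_max Phi s t.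
  by rewrite inE; apply/andP; split=> //; apply/forall_inP => q /max1.
have [p2 mp2 max2] := Order.TotalTheory.arg_maxP
  (fun p : (dist G s t).-tuple 'I_n => complex.Im (path_gain Phi s p)) mp1.
rewrite /opt_max; case: pickP => [p|/(_ p2)]; last first.
  by move=> /negP[]; apply/andP; split=> //; apply/forall_inP => q /max2.
rewrite inE => /andP[/andP[sp /forall_inP maxRe] /forall_inP maxIm].
exists p => //; split=> // q sq; split; first exact: maxRe.
move=> eqRe; apply: maxIm; rewrite inE sq eqRe; exact/forall_inP.
Qed.

Lemma opt_minP s t : connect G s t -> exists2 p,
  p \in shortest_paths G s t & opt_min Phi s t = path_gain Phi s p /\
  forall q, q \in shortest_paths G s t ->
    complex.Re (path_gain Phi s p) <= complex.Re (path_gain Phi s q) /\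
    (complex.Re (path_gain Phi s q) = complex.Re (path_gain Phi s p) ->
     complex.Im (path_gain Phi s p) <= complex.Im (path_gain Phi s q)).
Proof.
move=> /shortest_paths_nonempty[p0 sp0].
have [p1 sp1 min1] := Order.TotalTheory.arg_minP
  (fun p : (dist G s t).-tuple 'I_n => complex.Re (path_gain Phi s p)) sp0.
have mp1 : p1 \in shortest_min Phi s t.
  by rewrite inE; apply/andP; split=> //; apply/forall_inP => q /min1.
have [p2 mp2 min2] := Order.TotalTheory.arg_minP
  (fun p : (dist G s t).-tuple 'I_n => complex.Im (path_gain Phi s p)) mp1.
rewrite /opt_min; case: pickP => [p|/(_ p2)]; last first.
  by move=> /negP[]; apply/andP; split=> //; apply/forall_inP => q /min2.
rewrite inE => /andP[/andP[sp /forall_inP minRe] /forall_inP minIm].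
exists p => //; split=> // q sq; split; first exact: minRe.
move=> eqRe; apply: minIm; rewrite inE sq eqRe; exact/forall_inP.
Qed.

(** In the lexicographic order on real and imaginary parts, every shortest path has its gain between
    the two extremes. *)
Lemma opt_max_eq_min s t : connect G s t ->
  opt_max Phi s t = opt_min Phi s t <->
  forall p, p \in shortest_paths G s t -> path_gain Phi s p = opt_max Phi s t.
Proof.
move=> cst; have [p sp [-> maxp]] := opt_maxP cst.
have [q sq [-> minq]] := opt_minP cst; split=> [eqpq r sr|/(_ _ sq)->//].
have [leRe leIm] := maxp r sr; have [geRe geIm] := minq r sr.
rewrite -eqpq in geRe geIm.
have eqRe : complex.Re (path_gain Phi s r) = complex.Re (path_gain Phi s p).
  by apply/le_anti; rewrite leRe.
by apply/eqP; rewrite eq_complex eqRe eqxx eq_le leIm ?geIm.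
Qed.

End Gain.

Theorem theorem6p1 (R : realType) (n : nat) (G : sgraph n)
    (Phi : gain_graph R G) (hconn : connected_graph G) (hbip : bipartite G) :
  distance_compatible Phi <-> balanced Phi.
Proof.
split=> [compat|bal]; last first.
  have optE s t : opt_max Phi s t = opt_min Phi s t.
    apply/opt_max_eq_min => // p; rewrite inE => /and3P[Gp /eqP lastp _].
    have [q] := opt_maxP Phi (hconn s t).
    rewrite inE => /and3P[Gq /eqP lastq _] [-> _].
    by apply: balanced_walk_gain => //; rewrite lastp.
  by apply/matrixP => i j; rewrite !mxE /gain_max /gain_min !optE.
(* A root needs a vertex; over ['I_0] there is no cycle. *)
case: n => [|n] in G Phi hconn hbip compat *; first by case=> [|[]].
(* Taking the least vertex as root, only entries above the diagonal matter. *)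
pose s : 'I_n.+1 := ord0.
have thetaE t : forall p, p \in shortest_paths G s t ->
    path_gain Phi s p = opt_max Phi s t.
  (* The diagonal entry is zero and gives no information, but there the only shortest path is empty.
     Elsewhere the distance is nonzero and cancels. *)
  apply/opt_max_eq_min => //; have [<-|neq_st] := eqVneq s t.
    have [p sp [-> _]] := opt_maxP Phi (hconn s s).
    have [q sq [-> _]] := opt_minP Phi (hconn s s).
    have nilE (r : (dist G s s).-tuple 'I_n.+1) : r = [::] :> seq _.
      by apply: size0nil; apply/eqP; rewrite size_tuple dist_eq0.
    by rewrite !nilE.
  have /matrixP/(_ s t) := compat; rewrite !mxE /gain_max /gain_min.
  have -> : std_lt s t by rewrite /std_lt lt0n eq_sym.
  by apply: mulIf; rewrite pnatr_eq0 dist_eq0.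
have thetaS u v : G u v -> dist G s v = (dist G s u).+1 ->
    opt_max Phi s v = opt_max Phi s u * Phi u v.
  move=> Guv dE; have [p sp] := shortest_paths_nonempty (hconn s u).
  rewrite -(thetaE _ _ sp).
  move: sp; rewrite inE => /and3P[Gp /eqP lastp _].
  (* The prolonged walk has minimal length, which is what makes [v] new to it. *)
  have szp : size (rcons p v) == dist G s v by rewrite size_rcons size_tuple dE.
  rewrite -(thetaE v (Tuple szp)) ?path_gain_rcons ?lastp // inE.
  apply: shortest_walk_is_path; last exact/eqP.
    by rewrite rcons_path Gp lastp.
  by rewrite last_rcons.
apply: (@potential_balanced _ _ _ Phi (opt_max Phi s)) => [u|u v Guv].
  have [p] := opt_maxP Phi (hconn s u); rewrite inE => /and3P[Gp _ _] [-> _].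
  exact: path_gain_neq0.
have [] := bipartite_dist_adj hbip (hconn s u) (hconn s v) Guv.
  exact: thetaS.
(* Here [u] is the farther end: the edge is used from [v] to [u] and its gain inverted. *)
have Gvu : G v u by rewrite adj_sym.
move=> /(thetaS _ _ Gvu)->.
by rewrite (gain_inv Phi Gvu) mulfK ?gain_neq0.
Qed.
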